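(* Let $\mathbf p\in\mathbb Z^2\setminus\{0\}$ and suppose there exists at least one point $\mathbf q\in\mathcal Q(\mathbf p)$ of type $I_0$, where $\mathbf q$ is not parallel to $\mathbf p$. Let $\Gamma\in\mathbb R$ satisfy the normalization condition $\frac{\Gamma(\mathbf q\wedge\mathbf p)}{2\|\mathbf p\|^2}=1$, and consider the steady state $\omega^0(\mathbf x)=\Gamma\cos(\mathbf p\cdot\mathbf x)$, $\mathbf u^0(\mathbf x)=\frac{\Gamma}{\|\mathbf p\|^2}\sin(\mathbf p\cdot\mathbf x)\,\mathbf p^\perp$, with forcing $f=\|\mathbf p\|^2\Gamma\cos(\mathbf p\cdot\mathbf x)$, of the 2D Navier-Stokes equations $\partial_t\omega+\mathbf u\cdot\nabla\omega=\nu\Delta\omega+\nu f$ on $\mathbb T^2$. Then there exists $\nu_0>0$ such that for all $\nu\in(0,\nu_0)$ this steady state is linearly unstable. In particular, for every $s\ge 0$, the operator $L_{B,\mathbf q}$ in the space $\ell^2_s(\mathbb Z)$ has a positive eigenvalue, and therefore $L_B$ in $\ell^2_s(\mathbb Z^2)$ has a positive eigenvalue. Moreover, for all $\nu\in(0,\nu_0)$: $\lambda>0$ is an eigenvalue of $L_{B,\mathbf q}$ with eigenvector $(w_n)_{n\in\mathbb Z}$ satisfying the sign property (S) if and only if $\lambda>0$ is a solution of the equation $$a_0(\lambda,\nu)+f(\lambda,\nu)+g(\lambda,\nu)=0 .$$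
   Context: Notation. $\|\cdot\|$ is the Euclidean norm on $\mathbb Z^2$; for $\mathbf p=(p_1,p_2)$, $\mathbf q=(q_1,q_2)$ set $\mathbf p\wedge\mathbf q=p_1q_2-p_2q_1$ and $\mathbf p^\perp=(-p_2,p_1)$. $\nu>0$ is the viscosity. The torus is $\mathbb T^2=\mathbb R^2/(2\pi\mathbb Z)^2$; velocity and vorticity are related by $\mathbf u=(\psi_y,-\psi_x)$, $\omega=\operatorname{curl}\mathbf u=-\Delta\psi$. Point types. For $\mathbf q\in\mathbb Z^2$ let $\Sigma_{\mathbf q}=\{\mathbf q+n\mathbf p:n\in\mathbb Z\}$ and let $\widehat{\mathbf q}$ be the point of smallest norm in $\Sigma_{\mathbf q}$ (if there are two, the point $\mathbf q+n\mathbf p$ with larger $n$). $\mathcal Q(\mathbf p)=\{\widehat{\mathbf q}:\mathbf q\in\mathbb Z^2\}$. A point $\mathbf q\in\mathcal Q(\mathbf p)$ (so $\mathbf q=\widehat{\mathbf q}$) is of type $I_0$ if $\mathbf q$ is the only point of $\Sigma_{\mathbf q}$ in the open disk of radius $\|\mathbf p\|$ centered at $0$, and $\|\mathbf q+\mathbf p\|>\|\mathbf p\|$, $\|\mathbf q-\mathbf p\|>\|\mathbf p\|$. Operators. $\beta(\mathbf p,\mathbf q)=\frac12(\|\mathbf q\|^{-2}-\|\mathbf p\|^{-2})(\mathbf p\wedge\mathbf q)$ if $\mathbf p,\mathbf q\ne0$, and $\beta(\mathbf p,\mathbf q)=0$ otherwise. The linearization at the steady state, $L_B\omega=-\mathbf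 u^0\cdot\nabla\omega-\mathbf u\cdot\nabla\omega^0+\nu\Delta\omega$, is in Fourier coefficients the operator $$L_B:(\omega_{\mathbf k})_{\mathbf k\in\mathbb Z^2}\mapsto\big(\beta(\mathbf p,\mathbf k-\mathbf p)\Gamma\omega_{\mathbf k-\mathbf p}-\beta(\mathbf p,\mathbf k+\mathbf p)\Gamma\omega_{\mathbf k+\mathbf p}-\nu\|\mathbf k\|^2\omega_{\mathbf k}\big)_{\mathbf k\in\mathbb Z^2}.$$ Its restriction to sequences supported on $\Sigma_{\mathbf q}$, with $w_n=\omega_{\mathbf q+n\mathbf p}$, is (under the normalization of $\Gamma$) $$L_{B,\mathbf q}:(w_n)_{n\in\mathbb Z}\mapsto(\rho_{n-1}w_{n-1}-\rho_{n+1}w_{n+1}-\nu\|\mathbf q+n\mathbf p\|^2w_n)_{n\in\mathbb Z},\qquad \rho_n=\Gamma\beta(\mathbf p,\mathbf q+n\mathbf p)=1-\frac{\|\mathbf p\|^2}{\|\mathbf q+n\mathbf p\|^2}.$$ These unbounded operators are taken with their natural (maximal) domains. $\ell^2_s(\mathbb Z)$ is the space of sequences with $\sum_n(1+n^{2s})|w_n|^2<\infty$; $\ell^2_s(\mathbb Z^2)$ is the space with $\sum_{\mathbf k}(1+\|\mathbf k\|^{2s})|\omega_{\mathbf k}|^2<\infty$. The steady state is called linearly unstable if the linearized operator $L_B$ has an eigenvalue with positive real part. Continued fractions. $[c_1;c_2;\ldots]=\cfrac{1}{c_1+\cfrac{1}{c_2+\cdots}}$ denotes the limit of the truncations. For $\mathbf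 q$ of type $I_0$ (so $\rho_0<0$ and $\rho_n>0$ for $n\neq0$), $a_n(\lambda,\nu)=\frac{\lambda+\nu\|\mathbf q+n\mathbf p\|^2}{\rho_n}$, $f(\lambda,\nu)=[a_1;a_2;\ldots]$, $g(\lambda,\nu)=[a_{-1};a_{-2};\ldots]$. (The function $f(\lambda,\nu)$ is distinct from the forcing $f$.) Sign property (S) for a sequence $(w_n)$: either $w_n>0$ for $n>0$, $w_n<0$ for $n=-1,0$, and $(-1)^{|n|}w_n>0$ for $n\le-2$; or the entries of $(-w_n)$ satisfy these inequalities. *)

(* Defs.v *)
From HB Require Import structures.
From mathcomp Require Import all_boot all_order all_algebra.
From mathcomp Require Import all_classical all_reals all_analysis.
From mathcomp Require Import complex.

Set Implicit Arguments.
Unset Strict Implicit.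
Unset Printing Implicit Defensive.

Import Order.TTheory GRing.Theory Num.Theory.
Import numFieldNormedType.Exports.

Local Open Scope classical_set_scope.
Local Open Scope ring_scope.
Local Open Scope complex_scope.

Notation Z2 := (int * int)%type.

Section Lattice.
Variable R : realType.
Implicit Types p q r : Z2.

Definition nrm p : R := Num.sqrt (p.1%:~R ^+ 2 + p.2%:~R ^+ 2).

Definition wedge p q : int := p.1 * q.2 - p.2 * q.1.

Definition line p q : set Z2 := [set r | exists n : int, r = q + p *~ n].

(* [r] is the representative \hat q of the line through [q]; the quantified
   [n <= m] in case of equal norms implements "the point with larger n". *)
Definition is_hat p q r : Prop :=
  exists2 m : int, r = q + p *~ m &
    forall n : int, nrm r < nrm (q + p *~ n) \/
                    (nrm r = nrm (q + p *~ n) /\ n <= m).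

Definition hats p : set Z2 := [set r | exists q, is_hat p q r].

Definition type_I0 p q : Prop :=
  [/\ hats p q,
      forall r, line p q r -> (nrm r < nrm p <-> r = q),
      nrm p < nrm (q + p)
    & nrm p < nrm (q - p)].

Definition beta p q : R :=
  if (p == 0) || (q == 0) then 0
  else 2^-1 * ((nrm q) ^- 2 - (nrm p) ^- 2) * (wedge p q)%:~R.

End Lattice.

Section SteadyState.
Variable R : realType.
Implicit Types (F G psi omega f : R -> R -> R) (u : R -> R -> R * R).

Definition dx F (x y : R) : R := derive1 (fun t => F t y) x.
Definition dy F (x y : R) : R := derive1 (fun t => F x t) y.
Definition laplacian F (x y : R) : R := dx (dx F) x y + dy (dy F) x y.

Definition on_torus F : Prop :=
  forall x y, F (x + 2 * pi) y = F x y /\ F x (y + 2 * pi) = F x y.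

Definition steady_NS (nu : R) psi omega u f : Prop :=
  [/\ on_torus psi, on_torus f,
      forall x y, u x y = (dy psi x y, - dx psi x y),
      forall x y, omega x y = - laplacian psi x y
    & forall x y, (u x y).1 * dx omega x y + (u x y).2 * dy omega x y
                  = nu * laplacian omega x y + nu * f x y].

Variables (Gamma : R) (p : Z2).

Definition phase (x y : R) : R := p.1%:~R * x + p.2%:~R * y.
Definition psi0 (x y : R) : R := Gamma / nrm R p ^+ 2 * cos (phase x y).
Definition omega0 (x y : R) : R := Gamma * cos (phase x y).
Definition u0 (x y : R) : R * R :=
  (Gamma / nrm R p ^+ 2 * sin (phase x y) * (- p.2%:~R),
   Gamma / nrm R p ^+ 2 * sin (phase x y) * p.1%:~R).
Definition forcing (x y : R) : R := nrm R p ^+ 2 * Gamma * cos (phase x y).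

End SteadyState.

Section Operators.
Variable R : realType.

(* Squared modulus of a complex number, as an element of [R]. *)
Definition sqmod (z : R[i]) : R := complex.Re z ^+ 2 + complex.Im z ^+ 2.

Definition l2Z (s : R) : set (int -> R[i]) :=
  [set w | summable setT
     (fun n : int => ((1 + `|n%:~R : R| `^ (2 * s)) * sqmod (w n))%:E)].

Definition l2Z2 (s : R) : set (Z2 -> R[i]) :=
  [set w | summable setT
     (fun k : Z2 => ((1 + nrm R k `^ (2 * s)) * sqmod (w k))%:E)].

(* [L] is the formal operator on all sequences over [T]; as an unbounded
   operator in the space [H], its maximal domain is {w in H | L w in H}. *)
Definition eigenpair (T : Type) (H : set (T -> R[i]))
    (L : (T -> R[i]) -> T -> R[i]) (lambda : R[i]) (w : T -> R[i]) : Prop :=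
  [/\ H w, H (L w), exists t, w t != 0 & forall t, L w t = lambda * w t].

Definition eigenvalue_in (T : Type) (H : set (T -> R[i]))
    (L : (T -> R[i]) -> T -> R[i]) (lambda : R[i]) : Prop :=
  exists w, eigenpair H L lambda w.

Variables (Gamma : R) (p : Z2).

(* The linearization -u0.grad(omega) - u.grad(omega0) + nu Delta(omega) acting
   on the Fourier coefficients of omega = \sum_k w_k e_k, e_k = exp(i k.x):
   the two transport terms send e_k to
   Gamma * beta(p, k) * (e_(k + p) - e_(k - p)). *)
Definition LB (nu : R) (w : Z2 -> R[i]) (k : Z2) : R[i] :=
  (beta R p (k - p) * Gamma)%:C * w (k - p)
  - (beta R p (k + p) * Gamma)%:C * w (k + p)
  - (nu * nrm R k ^+ 2)%:C * w k.

Definition linearly_unstable (nu : R) : Prop :=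
  forall s : R, 0 <= s ->
    exists2 lambda : R[i], 0 < complex.Re lambda
                         & eigenvalue_in (l2Z2 s) (LB nu) lambda.

Variable q : Z2.

(* Equal to 1 - |p|^2 / |q + n p|^2 under the normalization
   Gamma (q wedge p) / (2 |p|^2) = 1. *)
Definition rho (n : int) : R := Gamma * beta R p (q + p *~ n).

Definition LBq (nu : R) (w : int -> R[i]) (n : int) : R[i] :=
  (rho (n - 1))%:C * w (n - 1) - (rho (n + 1))%:C * w (n + 1)
  - (nu * nrm R (q + p *~ n) ^+ 2)%:C * w n.

Definition acoef (lambda nu : R) (n : int) : R :=
  (lambda + nu * nrm R (q + p *~ n) ^+ 2) / rho n.

End Operators.

Section ContinuedFractions.
Variable R : realType.

(* 1 / (c 0 + 1 / (c 1 + ... + 1 / c N.-1)) *)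
Fixpoint cf_trunc (c : nat -> R) (N : nat) : R :=
  if N is N'.+1 then (c 0%N + cf_trunc (fun k => c k.+1) N')^-1 else 0.

Variables (Gamma : R) (p q : Z2).

Definition f_trunc (lambda nu : R) : nat -> R :=
  cf_trunc (fun k => acoef Gamma p q lambda nu k.+1%:Z).
Definition g_trunc (lambda nu : R) : nat -> R :=
  cf_trunc (fun k => acoef Gamma p q lambda nu (- k.+1%:Z)).

Definition f_cf (lambda nu : R) : R := limn (f_trunc lambda nu).
Definition g_cf (lambda nu : R) : R := limn (g_trunc lambda nu).

Definition characteristic_eq (lambda nu : R) : Prop :=
  [/\ cvgn (f_trunc lambda nu), cvgn (g_trunc lambda nu)
    & acoef Gamma p q lambda nu 0 + f_cf lambda nu + g_cf lambda nu = 0].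

End ContinuedFractions.

Section SignProperty.
Variable R : realType.

(* In the partial order of [R[i]], [0 < z] (resp. [z < 0]) means that [z] is
   a positive (resp. negative) real number. *)
Definition signS_pos (w : int -> R[i]) : Prop :=
  [/\ forall n : int, 0 < n -> 0 < w n,
      w (-1) < 0, w 0 < 0
    & forall n : int, n <= -2 -> 0 < (-1) ^+ `|n|%N * w n].

Definition signS (w : int -> R[i]) : Prop :=
  signS_pos w \/ signS_pos (fun n => - w n).

End SignProperty.

(* Main.v *)
Require Import Defs.
From mathcomp Require Import all_boot all_order all_algebra.
From mathcomp Require Import all_classical all_reals all_analysis.
From mathcomp Require Import complex ring lra zify.

Import Order.TTheory GRing.Theory Num.Theory.
Import numFieldNormedType.Exports.
Local Open Scope ring_scope.
Local Open Scope classical_set_scope.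
Local Open Scope complex_scope.

(** The eigenvalue equation of the operator on the line through [q] is a
three-term recurrence, and the substitution [z n = rho n * w n] puts it in the
form [z (n - 1) - z (n + 1) = a n * z n], with [a] the coefficients of the two
continued fractions.

Because [q] is of type I_0, the squared norm along the line is a convex
quadratic polynomial that is below [|p|^2] exactly at [n = 0].  Hence
[rho 0 < 0], while [rho n] stays between a positive constant and [1] for
[n != 0], so that [a n >= lambda > 0] off the origin and [a 0 < 0].

On a half-line where all coefficients are at least [m > 0], a positive
solution satisfies [r k = 1 / (c k + r k.+1)] for its ratios [r] of consecutive
terms.  Two steps of this map contract by a factor below [1]
([cf_two_steps]), whatever the size of the coefficients.  This single estimate
gives the convergence of the fraction ([cf_trunc_cvg]), the fact that the ratio
of any positive solution is the value of the fraction ([cf_uniq]), and the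
Lipschitz dependence of the value on the coefficients ([cf_lipschitz]).

The sign property says that the ratios of [z] are positive on the right half-line
and, after the alternating sign change, on the left half-line.  They are thus
[f] and [g], and the recurrence at [n = 0] reads [a_0 + f + g = 0]
([signS_characteristic]).  Conversely, products of the values of the successive
tails define a solution on each half-line, and the characteristic equation
glues them at [0] ([decaying_chainP]).  Each ratio is at most [1 / a n], and
[a n] grows without bound since the viscosity is positive, so the solution
decays faster than any power ([recessive_decay]) and lies in all the weighted
spaces; extended by zero off the line it is an eigenvector of the full operator.

A positive solution of the characteristic equation comes from the intermediate
value theorem.  For large [lambda] the negative term [a_0] dominates, as [f] and
[g] are at most [1 / lambda].  For small [lambda], and viscosity small
compared with [lambda], the coefficients far along the line are still of order
[lambda]; each pair of levels of the fraction then adds at least [lambda / 2]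
([cf_lower_bound]), so a number of levels depending only on [rho 0] makes
[f + g] at least [- a_0]. *)

(** * Continued fractions with coefficients bounded below *)

Section PositiveContinuedFractions.
Context {R : realType}.
Implicit Types (c : nat -> R) (m x y a b d : R).

(** Allowing an arbitrary last tail puts on the same footing the truncations,
where it is [0], and the expansion of a solution of the recurrence, where it is
the solution itself. *)
Fixpoint cf_tail c N x : R :=
  if N is N'.+1 then (c 0%N + cf_tail (fun k => c k.+1) N' x)^-1 else x.

Lemma cf_tail_trunc c N : cf_trunc c N = cf_tail c N 0.
Proof. by elim: N c => //= N IH c; rewrite IH. Qed.

Lemma cf_tail_cat c M N x :
  cf_tail c (M + N) x = cf_tail c M (cf_tail (fun k => c (M + k)%N) N x).
Proof. by elim: M c => //= M IH c; rewrite IH. Qed.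

Lemma cf_tail_bound c m N x : 0 < m -> (forall k, m <= c k) -> 0 <= x ->
  0 <= cf_tail c N x /\ ((0 < N)%N -> cf_tail c N x <= m^-1).
Proof.
move=> m0; elim: N c => [|N IH] c cm x0 //=.
have [t0 _] := IH (fun k => c k.+1) (fun k => cm k.+1) x0.
have ct : m <= c 0%N + cf_tail (fun k => c k.+1) N x by rewrite ler_wpDr.
split; first by rewrite invr_ge0 (le_trans (ltW m0)).
by move=> _; rewrite lef_pV2// posrE// (lt_le_trans m0).
Qed.

Lemma cf_one_step m a b x y : 0 < m -> m <= a -> m <= b -> 0 <= x -> 0 <= y ->
  `|(a + x)^-1 - (b + y)^-1| <= (`|a - b| + `|x - y|) / m ^+ 2.
Proof.
move=> m0 ma mb x0 y0.
have X0 : m <= a + x by lra.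
have Y0 : m <= b + y by lra.
have Xn : a + x != 0 by apply: lt0r_neq0; lra.
have Yn : b + y != 0 by apply: lt0r_neq0; lra.
have -> : (a + x)^-1 - (b + y)^-1 = - ((a - b) + (x - y)) / ((a + x) * (b + y)).
  by field; rewrite Xn Yn.
rewrite normrM normrN normfV; apply: ler_pM; rewrite ?invr_ge0 ?normr_ge0//.
  exact: ler_normD.
rewrite ger0_norm; last by apply: mulr_ge0; lra.
by rewrite lef_pV2 ?posrE ?mulr_gt0 ?exprn_gt0//; [nra|lra|lra].
Qed.

(** One step of the fraction need not contract when the coefficients are small;
two steps do, because the derivative of [x -> 1 / (a + 1 / (b + x))] is
[(1 + a * (b + x))^-2], at most [(1 + m^2)^-2], hence below [(1 + m^2)^-1].
The last term accounts for a change of coefficients: the derivatives are at most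
[1 / m^2] in [a] and [1] in [b], in absolute value. *)
Lemma cf_two_steps m a b a' b' d x y : 0 < m ->
    m <= a -> m <= b -> m <= a' -> m <= b' -> 0 <= x -> 0 <= y ->
    `|a - a'| <= d -> `|b - b'| <= d ->
  `|(a + (b + x)^-1)^-1 - (a' + (b' + y)^-1)^-1|
    <= (1 + m ^+ 2)^-1 * `|x - y| + (1 + (m ^+ 2)^-1) * d.
Proof.
move=> m0 ma mb ma' mb' x0 y0 da db.
set X := b + x; set Y := b' + y.
have X0 : m <= X by rewrite /X; lra.
have Y0 : m <= Y by rewrite /Y; lra.
have m20 : 0 < m ^+ 2 by rewrite exprn_gt0.
have P0 : 1 + m ^+ 2 <= 1 + a * X by nra.
have Q0 : 1 + m ^+ 2 <= 1 + a' * Y by nra.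
have Xn : X != 0 by apply: lt0r_neq0; lra.
have Yn : Y != 0 by apply: lt0r_neq0; lra.
have Pn : 1 + a * X != 0 by apply: lt0r_neq0; lra.
have Qn : 1 + a' * Y != 0 by apply: lt0r_neq0; lra.
have -> : (a + X^-1)^-1 - (a' + Y^-1)^-1 =
    (X - Y) / ((1 + a * X) * (1 + a' * Y))
    - (a - a') * (X / (1 + a * X)) * (Y / (1 + a' * Y)).
  by field; rewrite Xn Yn Pn Qn.
have d0 : 0 <= d by apply: le_trans da.
have key b1 Z : m <= b1 -> m <= Z -> 0 <= Z / (1 + b1 * Z) <= m^-1.
  move=> mb1 mZ; have q0 : 0 < 1 + b1 * Z by nra.
  rewrite divr_ge0 ?(ltW q0)//=; last lra.
  by rewrite ler_pdivrMr// mulrC ler_pdivlMr//; nra.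
have /andP[k1 k1'] := key a X ma X0; have /andP[k2 k2'] := key a' Y ma' Y0.
set u := X / _ in k1 k1' *; set v := Y / _ in k2 k2' *.
apply: le_trans (ler_normB _ _) _.
have -> : (1 + m ^+ 2)^-1 * `|x - y| + (1 + (m ^+ 2)^-1) * d =
   (1 + m ^+ 2)^-1 * `|x - y| + d + d * (m ^+ 2)^-1 by ring.
apply: lerD; last first.
  rewrite 2!normrM -mulrA; apply: ler_pM => //; rewrite ?mulr_ge0//.
  by rewrite !ger0_norm// expr2 invfM; apply: ler_pM.
rewrite normrM normfV [`|_ * (_ + _)|]ger0_norm; last by apply: mulr_ge0; lra.
have XY : `|X - Y| <= `|x - y| + d.
  have -> : X - Y = (x - y) + (b - b') by rewrite /X /Y; ring.
  by apply: le_trans (ler_normD _ _) _; rewrite lerD2l.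
have PQ : ((1 + a * X) * (1 + a' * Y))^-1 <= (1 + m ^+ 2)^-1.
  by rewrite lef_pV2 ?posrE//; nra.
have I1 : (1 + m ^+ 2)^-1 <= 1 by rewrite invf_le1; lra.
have I0 : 0 <= (1 + m ^+ 2)^-1 by rewrite invr_ge0; lra.
apply: (@le_trans _ _ ((`|x - y| + d) * (1 + m ^+ 2)^-1)).
  by apply: ler_pM => //; rewrite invr_ge0; nra.
by rewrite mulrDl mulrC lerD2l; nra.
Qed.

(** [cf_lip m] is the fixed point of [L -> cf_rate m * L + (1 + m^-2)], the
accumulated effect of perturbing every pair of levels. *)
Definition cf_rate m : R := (1 + m ^+ 2)^-1.
Definition cf_lip m : R := (1 + (m ^+ 2)^-1) / (1 - cf_rate m).

Lemma cf_rate_itv m : 0 < m -> 0 < cf_rate m < 1.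
Proof.
move=> m0; have m20 : 0 < m ^+ 2 by rewrite exprn_gt0.
by rewrite /cf_rate invr_gt0 invf_lt1; lra.
Qed.

(** Iterating the two-step estimate; the factor [1 + m^-2] in front of the
dependence on the tails absorbs the single step left over when the number of
levels is odd. *)
Lemma cf_tail_lip m c c' d N x y : 0 < m ->
    (forall k, m <= c k) -> (forall k, m <= c' k) ->
    (forall k, `|c k - c' k| <= d) -> 0 <= x -> 0 <= y ->
  `|cf_tail c N x - cf_tail c' N y|
    <= cf_rate m ^+ N./2 * ((1 + (m ^+ 2)^-1) * `|x - y|) + cf_lip m * d.
Proof.
move=> m0; have [k k1] := ubnP N.
elim: k N k1 c c' => // k IH N k1 c c' cm cm' cd x0 y0.
have /andP[r0 r1] := cf_rate_itv _ m0.
have d0 : 0 <= d by apply: le_trans (cd 0%N).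
have i0 : 0 < (m ^+ 2)^-1 by rewrite invr_gt0 exprn_gt0.
have L1 : 1 + (m ^+ 2)^-1 <= cf_lip m.
  by rewrite /cf_lip ler_pdivlMr; [nra|lra].
have n0 : 0 <= `|x - y| by [].
case: N k1 => [|[|N]] k1.
- by rewrite /= expr0 mul1r; nra.
- rewrite /= expr0 mul1r.
  apply: le_trans (cf_one_step m _ _ _ _ m0 (cm _) (cm' _) x0 y0) _.
  by have := cd 0%N; nra.
have [t0 _] := cf_tail_bound (fun k => c k.+2) m N x m0 (fun k => cm k.+2) x0.
have [t0' _] := cf_tail_bound (fun k => c' k.+2) m N y m0 (fun k => cm' k.+2) y0.
have := cf_two_steps m _ _ _ _ d _ _ m0 (cm 0%N) (cm 1%N) (cm' 0%N) (cm' 1%N)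
  t0 t0' (cd 0%N) (cd 1%N).
move=> /le_trans; apply.
have Nk : (N < k)%N by lia.
have := IH N Nk (fun k => c k.+2) (fun k => c' k.+2) (fun k => cm k.+2)
  (fun k => cm' k.+2) (fun k => cd k.+2) x0 y0.
rewrite -/(cf_rate m) (_ : N.+2./2 = N./2.+1)// (exprS (cf_rate m)) /=.
set D := `|_ - _|; set E := _ ^+ _ * _; move=> H.
have -> : cf_rate m * cf_rate m ^+ N./2 * ((1 + (m ^+ 2)^-1) * `|x - y|) = cf_rate m * E.
  by rewrite /E; ring.
have -> : 1 + (m ^+ 2)^-1 = cf_lip m * (1 - cf_rate m).
  by rewrite /cf_lip divfK//; apply: lt0r_neq0; lra.
by nra.
Qed.

(** The value forgets its last tail geometrically fast.  Every tail of at least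
one level is between [0] and [1 / m], so the bound is uniform over tails. *)
Lemma cf_tail_forget m c N x y : 0 < m -> (forall k, m <= c k) ->
    0 <= x <= m^-1 -> 0 <= y <= m^-1 ->
  `|cf_tail c N x - cf_tail c N y|
    <= cf_rate m ^+ N./2 * ((1 + (m ^+ 2)^-1) * m^-1).
Proof.
move=> m0 cm /andP[x0 x1] /andP[y0 y1].
have cc k : `|c k - c k| <= 0 by rewrite subrr normr0.
apply: le_trans (cf_tail_lip m c c 0 N x y m0 cm cm cc x0 y0) _.
have /andP[r0 r1] := cf_rate_itv _ m0.
rewrite mulr0 addr0; apply: ler_wpM2l; first by rewrite exprn_ge0// ltW.
apply: ler_wpM2l; last by rewrite ler_norml; apply/andP; split; lra.
by rewrite addr_ge0// invr_ge0 exprn_ge0// ltW.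
Qed.

Lemma cf_error_small m (e : R) : 0 < m -> 0 < e ->
  exists M, forall N, (M <= N)%N -> cf_rate m ^+ N./2 * ((1 + (m ^+ 2)^-1) * m^-1) < e.
Proof.
move=> m0 e0; have /andP[r0 r1] := cf_rate_itv _ m0.
set G := (_ * m^-1).
have G0 : 0 < G by rewrite mulr_gt0 ?addr_gt0 ?invr_gt0 ?exprn_gt0.
have /cvg_expr : `|cf_rate m| < 1 by rewrite ger0_norm// ltW.
move=> /cvgrPdist_lt /(_ (e / G)); rewrite divr_gt0// => /(_ isT) [M _ HM].
exists M.*2 => N MN; rewrite -ltr_pdivlMr//.
have /HM : (M <= N./2)%N by lia.
by rewrite /= sub0r normrN ger0_norm// exprn_ge0// ltW.
Qed.

(** A longer truncation is a shorter one with another last tail, so the sequence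
of truncations is Cauchy. *)
Lemma cf_trunc_cvg m c : 0 < m -> (forall k, m <= c k) -> cvgn (cf_trunc c).
Proof.
move=> m0 cm; apply/cauchy_cvgP/cauchy_exP => e e0.
have [M HM] := cf_error_small m e m0 e0.
exists (cf_trunc c M); exists M => // N /= MN.
rewrite -ball_normE/=; apply: le_lt_trans (HM M (leqnn _)).
have -> : cf_trunc c N = cf_tail c M (cf_tail (fun k => c (M + k)%N) (N - M) 0).
  by rewrite -cf_tail_cat subnKC// cf_tail_trunc.
rewrite cf_tail_trunc; apply: cf_tail_forget => //.
  by rewrite lexx invr_ge0 ltW.
have [-> /=|NM] := posnP (N - M)%N; first by rewrite lexx invr_ge0 ltW.
have [t0 t1] := cf_tail_bound (fun k => c (M + k)%N) m (N - M) 0 m0 (fun k => cm _) (lexx 0).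
by rewrite t0 t1.
Qed.

Definition cf c : R := limn (cf_trunc c).

Lemma cf_ge0 m c : 0 < m -> (forall k, m <= c k) -> 0 <= cf c.
Proof.
move=> m0 cm; apply: limr_ge; first exact: cf_trunc_cvg cm.
by near=> N; rewrite cf_tail_trunc; have [] := cf_tail_bound c m N 0 m0 cm (lexx 0).
Unshelve. all: by end_near. Qed.

Lemma cf_rec m c : 0 < m -> (forall k, m <= c k) ->
  cf c = (c 0%N + cf (fun k => c k.+1))^-1.
Proof.
move=> m0 cm; apply/cvg_lim => //.
rewrite -(cvg_shiftS (cf_trunc c)) /=.
have cm1 k : m <= c k.+1 by [].
have t0 : 0 <= cf (fun k => c k.+1) by apply: cf_ge0 cm1.
apply: cvgV; first by apply: lt0r_neq0; have := cm 0%N; lra.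
apply: cvgD; first exact: cvg_cst.
exact: cf_trunc_cvg cm1.
Qed.

Lemma cf_gt0 m c : 0 < m -> (forall k, m <= c k) -> 0 < cf c.
Proof.
move=> m0 cm; rewrite (cf_rec m)// invr_gt0.
have := cf_ge0 m (fun k => c k.+1) m0 (fun k => cm k.+1).
by have := cm 0%N; lra.
Qed.

Lemma cf_le m c : 0 < m -> (forall k, m <= c k) -> cf c <= (c 0%N)^-1.
Proof.
move=> m0 cm; rewrite (cf_rec m)//.
have t0 := cf_ge0 m (fun k => c k.+1) m0 (fun k => cm k.+1).
by have := cm 0%N => c0; rewrite lef_pV2 ?posrE; lra.
Qed.

(** [x 0] is, for every number of levels, the fraction with last tail [x N], hence
as close as desired to the truncations. *)
Lemma cf_uniq m c (x : nat -> R) : 0 < m -> (forall k, m <= c k) ->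
    (forall k, 0 <= x k) -> (forall k, x k = (c k + x k.+1)^-1) ->
  x 0%N = cf c.
Proof.
move=> m0 cm x0 xE; apply/esym/cvg_lim => //.
have xm k : x k <= m^-1.
  by rewrite xE lef_pV2 ?posrE//; have := x0 k.+1; have := cm k; lra.
have xN N : x 0%N = cf_tail c N (x N).
  suff gen j i : x j = cf_tail (fun k => c (j + k)%N) i (x (j + i)%N) by exact: gen 0%N N.
  elim: i j => [|i IH] j /=; first by rewrite addn0.
  rewrite xE addn0 (IH j.+1) addSnnS.
  by under [in RHS]eq_fun do rewrite -addSnnS.
apply/cvgrPdist_lt => e e0; have [M HM] := cf_error_small m e m0 e0.
exists M => // N /= /HM; apply: le_lt_trans.
rewrite (xN N) cf_tail_trunc; apply: cf_tail_forget; rewrite ?x0 ?xm//.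
by rewrite lexx invr_ge0 ltW.
Qed.

Lemma cf_lipschitz m c c' d : 0 < m ->
    (forall k, m <= c k) -> (forall k, m <= c' k) ->
    (forall k, `|c k - c' k| <= d) ->
  `|cf c - cf c'| <= cf_lip m * d.
Proof.
move=> m0 cm cm' cd.
have v := cf_trunc_cvg m c m0 cm; have v' := cf_trunc_cvg m c' m0 cm'.
rewrite /cf -limB// -lim_norm; last exact: is_cvgB.
apply: limr_le; first by apply: is_cvg_norm; apply: is_cvgB.
near=> N; have := cf_tail_lip m c c' d N 0 0 m0 cm cm' cd (lexx _) (lexx _).
rewrite -!cf_tail_trunc subrr normr0 !mulr0 add0r; exact.
Unshelve. all: by end_near. Qed.

(** When [a] and [b] are of order [l] and [x] is small, [1 / (a + 1 / (b + x))]
is about [b + x], so each pair of levels adds a fixed multiple of [l].  The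
smallness condition gives [C * (x + l / 2) * (x + l) <= 1 / 2] for every [x]
reached, which makes the increment at least [l / 2]. *)
Lemma cf_lower_bound K c (l C : R) : 0 < l -> 0 < C ->
    (forall k, l <= c k) -> (forall k, (k < K.*2)%N -> c k <= C * l) ->
    2 * C * (K.+1%:R * l) ^+ 2 <= 1 ->
  K%:R * l / 2 <= cf c.
Proof.
move=> l0 C0; elim: K c => [|K IH] c cl cC sm.
  by rewrite mul0r mul0r; apply: cf_ge0 cl.
set t := cf (fun k => c k.+2).
have cl1 k : l <= c k.+1 by [].
have cl2 k : l <= c k.+2 by [].
have tlow : K%:R * l / 2 <= t.
  apply: IH => // [k kK|]; first by apply: cC; lia.
  apply: le_trans sm; rewrite ler_pM2l ?mulr_gt0//.
  by rewrite lerXn2r ?nnegrE ?mulr_ge0 ?ler_wpM2r ?ler_nat// ltW.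
have -> : cf c = (c 0%N + (c 1%N + t)^-1)^-1.
  by rewrite (cf_rec l c)// (cf_rec l (fun k => c k.+1)).
have t0 : 0 <= t by apply: cf_ge0 cl2.
have c0 := cl 0%N; have c1 := cl 1%N.
have C0' : c 0%N <= C * l by apply: cC.
set x := K%:R * l / 2 in tlow *.
have x0 : 0 <= x by rewrite /x !mulr_ge0// ltW.
have -> : K.+1%:R * l / 2 = x + l / 2 by rewrite /x -natr1; ring.
have {sm} : 2 * C * (2 * (x + l)) ^+ 2 <= 1.
  move: sm; have -> // : K.+2%:R * l = 2 * (x + l).
  by rewrite /x -natr1 -natr1; field.
set y := x + l / 2; move=> sm.
have y0 : 0 < y by rewrite /y; lra.
have lx0 : 0 < l + x by lra.
rewrite -(invrK y) lef_pV2 ?posrE ?invr_gt0//; last first.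
  by rewrite addr_gt0 ?invr_gt0; lra.
apply: (@le_trans _ _ (C * l + (l + x)^-1)).
  by rewrite lerD// lef_pV2 ?posrE; lra.
(* Clearing denominators leaves [C * l * y * (l + x) + y <= l + x]. *)
rewrite -(@ler_pM2r _ (y * (l + x))) ?mulr_gt0//.
have -> : (C * l + (l + x)^-1) * (y * (l + x)) = C * l * y * (l + x) + y.
  by field; apply: lt0r_neq0.
have -> : y^-1 * (y * (l + x)) = l + x by field; apply: lt0r_neq0.
have : C * (y * (l + x)) <= 1 / 2.
  have : y * (l + x) <= (x + l) ^+ 2 by rewrite /y; nra.
  by nra.
move=> H; have : l * (C * (y * (l + x))) <= l * (1 / 2) by rewrite ler_pM2l.
by rewrite /y; lra.
Qed.

End PositiveContinuedFractions.

(** * Weighted summability *)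

Section Summability.
Context {R : realType}.

Lemma esum_nat_geometric (a : nat -> R) (C : R) :
    (forall n, 0 <= a n <= C * 2^-1 ^+ n) ->
  (\esum_(n in [set: nat]) (a n)%:E < +oo)%E.
Proof.
move=> aC; rewrite -nneseries_esumT; last by move=> n; rewrite lee_fin; have /andP[] := aC n.
apply: (@le_lt_trans _ _ (\sum_(0 <= n <oo) (C * 2^-1 ^+ n)%:E)%E).
  apply: lee_nneseries => n _; first by rewrite lee_fin; have /andP[] := aC n.
  by rewrite lee_fin; have /andP[] := aC n.
have := @cvg_geometric_eseries_half R (2 * C) 0.
have -> : (fun k => (2 * C / (2 ^ (k + 1))%:R)%:E) = (fun n => (C * 2^-1 ^+ n)%:E).
  apply/funext => i; congr EFin.
  by rewrite addn1 natrX exprS invfM exprVn; field; rewrite ?expf_neq0.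
by move=> /cvg_lim ->//; rewrite ltry.
Qed.

Lemma summable_int_geometric (a : int -> R) (C : R) :
    (forall n, 0 <= a n <= C * 2^-1 ^+ `|n|%N) ->
  summable [set: int] (fun n => (a n)%:E).
Proof.
move=> aC; rewrite /summable.
have -> : (fun n => `|(a n)%:E|%E) = (fun n => (a n)%:E).
  by apply/funext => n; rewrite abse_EFin ger0_norm//; have /andP[] := aC n.
rewrite (esumID (range Posz)); last by move=> n _; rewrite lee_fin; have /andP[] := aC n.
have -> : [set: int] `&` ~` range Posz = range Negz.
  rewrite setTI; apply/seteqP; split => [[n|n] /= H|_ [n _ <-] [k _]] //.
    by case: H; exists n.
  by exists n.
rewrite setTI !esum_image; [|by move=> x y _ _ []..].
apply: lte_add_pinfty.
  by apply: (@esum_nat_geometric (fun n => a n) C) => n; exact: aC.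
apply: (@esum_nat_geometric (fun n => a (Negz n)) C) => n; have /andP[-> h] := aC (Negz n).
have C0 : 0 <= C by have := aC 0; rewrite expr0 mulr1 => /andP[/le_trans]; apply.
apply: le_trans h _.
by rewrite ler_wpM2l// exprS ler_piMl ?exprn_ge0//; lra.
Qed.

(** The geometric factor makes the weighted sums converge at once, and the
arbitrary power absorbs the weight of every space at the same time. *)
Definition rapidly_decaying (w : int -> R[i]) : Prop := forall M : nat,
  exists C : R, forall n, (1 + `|n|)%N%:R ^+ M * sqmod (w n) <= C * 2^-1 ^+ `|n|%N.

Lemma sqmod_ge0 (z : R[i]) : 0 <= sqmod z.
Proof. by rewrite addr_ge0 ?sqr_ge0. Qed.

Lemma sqmodZ (a : R) (z : R[i]) : sqmod (a%:C * z) = a ^+ 2 * sqmod z.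
Proof. by case: z => x y; rewrite /sqmod /=; ring. Qed.

Lemma rapidly_decayingZ (a : R) (w : int -> R[i]) :
  rapidly_decaying w -> rapidly_decaying (fun n => a%:C * w n).
Proof.
move=> dw M; have [C HC] := dw M; exists (a ^+ 2 * C) => n.
by rewrite sqmodZ mulrCA -mulrA ler_wpM2l ?sqr_ge0.
Qed.

(** The size [x] may be any function of linear growth: both the index [|n|] and
the Euclidean norm of the [n]-th point of a line are of this kind. *)
Lemma rapidly_decaying_summable (w : int -> R[i]) (x : int -> R) (K s : R) :
    1 <= K -> (forall n, 0 <= x n <= K * (1 + `|n|)%N%:R) -> 0 <= s ->
  rapidly_decaying w ->
  summable [set: int] (fun n => ((1 + x n `^ (2 * s)) * sqmod (w n))%:E).
Proof.
move=> K1 xK s0 /(_ (Num.bound (2 * s))) [C HC].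
set M := Num.bound _ in HC.
have K0 : 0 <= K ^+ M by rewrite exprn_ge0//; lra.
apply: (@summable_int_geometric _ (2 * K ^+ M * C)) => n.
have /andP[x0 xn] := xK n; have w0 := sqmod_ge0 (w n).
apply/andP; split; first by apply: mulr_ge0 => //; rewrite addr_ge0 ?powR_ge0.
have H1 : 1 <= K * (1 + `|n|)%N%:R by rewrite mulr_ege1// ler1n.
have : x n `^ (2 * s) <= (K * (1 + `|n|)%N%:R) ^+ M.
  apply: (@le_trans _ _ ((K * (1 + `|n|)%N%:R) `^ (2 * s))).
    by apply: ge0_ler_powR; rewrite ?nnegrE; lra.
  rewrite -powR_mulrn; last lra.
  by apply: ler_powR => //; apply/ltW/archi_boundP; lra.
have : 1 <= (K * (1 + `|n|)%N%:R) ^+ M by apply: exprn_ege1.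
move=> e1 e2; apply: (@le_trans _ _ (2 * (K * (1 + `|n|)%N%:R) ^+ M * sqmod (w n))).
  by apply: ler_wpM2r => //; lra.
rewrite exprMn -[leRHS]mulrA.
have -> : 2 * (K ^+ M * (1 + `|n|)%:R ^+ M) * sqmod (w n) =
  2 * K ^+ M * ((1 + `|n|)%:R ^+ M * sqmod (w n)) by ring.
by rewrite ler_wpM2l// mulr_ge0.
Qed.

Lemma rapidly_decaying_l2Z (w : int -> R[i]) (s : R) : 0 <= s ->
  rapidly_decaying w -> l2Z s w.
Proof.
move=> s0 dw; apply: (@rapidly_decaying_summable w _ 1 s _ _ s0 dw) => // n.
by rewrite normr_ge0/= mul1r natrD natr_absz intr_norm; lra.
Qed.

End Summability.

(** * Sequences supported on a line of the lattice *)

Section LineExtension.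
Context {R : realType}.
Variables (p q : Z2).
Hypothesis p_neq0 : p != 0.
Implicit Types w : int -> R[i].

Definition line_ext w (k : Z2) : R[i] :=
  if pselect (exists n : int, k = q + p *~ n) is left ex
  then w (projT1 (cid ex)) else 0.

Lemma pairMz (n : int) : p *~ n = (p.1 * n, p.2 * n).
Proof. by rewrite [LHS]surjective_pairing (raddfMz fst) (raddfMz snd) !mulrzz. Qed.

Lemma line_inj : injective (fun n : int => q + p *~ n).
Proof.
move=> m n /addrI; rewrite !pairMz => -[e1 e2].
have : (p.1 != 0) || (p.2 != 0).
  rewrite -negb_and; apply: contra p_neq0 => /andP[/eqP a /eqP b].
  by rewrite [p]surjective_pairing a b.
case/orP => pn.
  by apply: (mulfI pn).
by apply: (mulfI pn).
Qed.

Lemma line_ext_line w n : line_ext w (q + p *~ n) = w n.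
Proof.
rewrite /line_ext; case: pselect => [ex|[]]; last by exists n.
by case: cid => m /= /line_inj ->.
Qed.

Lemma line_ext_out w k : ~ (exists n : int, k = q + p *~ n) -> line_ext w k = 0.
Proof. by rewrite /line_ext; case: pselect. Qed.

End LineExtension.

(** * Norms along a line of the lattice *)

Section LatticeGeometry.
Context {R : realType}.
Implicit Types p q : Z2.

Definition dot p q : R := p.1%:~R * q.1%:~R + p.2%:~R * q.2%:~R.

Lemma nrm_ge0 p : 0 <= nrm R p. Proof. exact: sqrtr_ge0. Qed.

Lemma nrm_sq p : nrm R p ^+ 2 = dot p p.
Proof. by rewrite sqr_sqrtr ?addr_ge0 ?sqr_ge0// /dot -!expr2. Qed.

Lemma nrm_lt p q : (nrm R p < nrm R q) = (nrm R p ^+ 2 < nrm R q ^+ 2).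
Proof. by rewrite ltr_sqr ?nnegrE ?nrm_ge0. Qed.

Lemma nrm_line p q (n : int) :
  nrm R (q + p *~ n) ^+ 2 = nrm R q ^+ 2 + 2 * dot p q * n%:~R + nrm R p ^+ 2 * n%:~R ^+ 2.
Proof. by rewrite !nrm_sq /dot pairMz /= !rmorphD !rmorphM /=; ring. Qed.

Lemma nrm_gt0 p : p != 0 -> 0 < nrm R p.
Proof.
move=> pn; rewrite lt_neqAle nrm_ge0 andbT eq_sym; apply: contra pn => /eqP p0.
have := nrm_sq p; rewrite p0 expr0n /= /dot -!expr2 => /esym/eqP.
rewrite paddr_eq0 ?sqr_ge0// !sqrf_eq0 !intr_eq0 => /andP[/eqP a /eqP b].
by rewrite [p]surjective_pairing a b.
Qed.

Lemma wedge_line p q (n : int) : wedge p (q + p *~ n) = wedge p q.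
Proof. by rewrite /wedge pairMz /=; ring. Qed.

End LatticeGeometry.

(** * Positive and recessive solutions of the recurrence on a half-line *)

Section Recurrence.
Context {R : realType}.
Implicit Types (c y : nat -> R) (m e : R).

(** Dividing the recurrence by [y k.+1] shows that the ratios of consecutive
terms solve the recursion of the tails of the fraction. *)
Lemma cf_of_positive_solution m c y : 0 < m -> (forall k, m <= c k) ->
    (forall k, 0 < y k) -> (forall k, y k = y k.+2 + c k * y k.+1) ->
  y 1%N / y 0%N = cf c.
Proof.
move=> m0 cm y0 yE; apply: (@cf_uniq _ m c (fun k => y k.+1 / y k)) => // k.
  by rewrite divr_ge0 ?ltW.
have yn j : y j != 0 by apply: lt0r_neq0.
rewrite -invf_div; congr (_^-1); rewrite [in LHS](yE k).
by field.
Qed.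

(** The solution whose ratios of consecutive terms are the values of the tails:
it is the one singled out by Pincherle's theorem. *)
Fixpoint recessive c (k : nat) : R :=
  if k is k'.+1 then recessive c k' * cf (fun i => c (k' + i)%N) else 1.

Lemma recessive_gt0 m c k : 0 < m -> (forall k, m <= c k) -> 0 < recessive c k.
Proof.
move=> m0 cm; elim: k => //= k IH.
by rewrite mulr_gt0// (cf_gt0 m).
Qed.

Lemma recessive_rec m c k : 0 < m -> (forall k, m <= c k) ->
  recessive c k = recessive c k.+2 + c k * recessive c k.+1.
Proof.
move=> m0 cm /=; rewrite (cf_rec m (fun i => c (k + i)%N))// addn0.
under [X in cf X]eq_fun do rewrite addnS -addSn.
set t := cf _; have t0 : 0 < t by apply: (cf_gt0 m).
have := cm k => ck; field; apply: lt0r_neq0; lra.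
Qed.

(** The ratio of consecutive terms is at most [1 / c k], which tends to [0].
Beyond some index the weighted square [v] is therefore nonincreasing: the power
[(1 + k)^M] grows by a factor at most [2^M] per step and [2^k] by [2], while the
square of the ratio is at most [2^-(M+1)]. *)
Lemma recessive_decay m e c : 0 < m -> 0 < e -> (forall k, m <= c k) ->
    (forall k, e * k%:R <= c k) ->
  forall M, exists2 C, 0 <= C & forall k,
    (1 + k)%N%:R ^+ M * recessive c k ^+ 2 <= C * 2^-1 ^+ k.
Proof.
move=> m0 e0 cm ce M.
pose v k := (1 + k)%N%:R ^+ M * recessive c k ^+ 2 * 2 ^+ k.
have v0 k : 0 <= v k by rewrite !mulr_ge0 ?exprn_ge0// ltW// (recessive_gt0 m).
have [k0 Hk0] : exists k0 : nat, forall k, (k0 <= k)%N -> 2 ^+ M.+1 <= c k.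
  exists (Num.bound (2 ^+ M.+1 / e)) => k kk; apply: le_trans (ce k).
  rewrite mulrC -ler_pdivrMr//; apply: (@le_trans _ _ (Num.bound (2 ^+ M.+1 / e))%:R).
    by apply/ltW/archi_boundP; rewrite divr_ge0 ?exprn_ge0 ?ltW.
  by rewrite ler_nat.
have vdec k : (k0 <= k)%N -> v k.+1 <= v k.
  move=> /Hk0 ck; rewrite /v /=.
  set u := recessive c k; set t := cf _.
  have t0 : 0 < t by apply: (cf_gt0 m).
  have P1 : 2 <= (2 : R) ^+ M.+1 by rewrite exprS ler_peMr// exprn_ege1// ler1n.
  have t1 : t <= (2 ^+ M.+1)^-1.
    apply: le_trans (cf_le m _ m0 _) _ => //; rewrite addn0.
    by rewrite lef_pV2 ?posrE ?exprn_gt0//; lra.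
  have t2 : t <= 1 by apply: le_trans t1 _; rewrite invf_le1; lra.
  have t3 : 2 ^+ M.+1 * t ^+ 2 <= 1.
    apply: (@le_trans _ _ (2 ^+ M.+1 * t)); last by rewrite mulrC -ler_pdivlMr ?mul1r//; lra.
    by rewrite ler_wpM2l ?exprn_ge0// expr2 ler_piMl// ltW.
  have k1 : (1 + k.+1)%N%:R ^+ M <= (2 : R) ^+ M * (1 + k)%N%:R ^+ M.
    rewrite -exprMn lerXn2r ?nnegrE ?mulr_ge0//.
    by rewrite -natrM ler_nat; lia.
  apply: (@le_trans _ _ (2 ^+ M * (1 + k)%N%:R ^+ M * (u * t) ^+ 2 * 2 ^+ k.+1)).
    by rewrite ler_wpM2r ?exprn_ge0// ler_wpM2r ?sqr_ge0.
  have -> : 2 ^+ M * (1 + k)%N%:R ^+ M * (u * t) ^+ 2 * 2 ^+ k.+1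
     = (1 + k)%N%:R ^+ M * u ^+ 2 * 2 ^+ k * (2 ^+ M.+1 * t ^+ 2).
    by rewrite !exprS; ring.
  by rewrite ler_piMr//; exact: (v0 k).
(* The sum of the first terms is a bound for their maximum. *)
exists (\sum_(i < k0.+1) v i); first by rewrite sumr_ge0.
suff H k : v k <= \sum_(i < k0.+1) v i.
  move=> k; rewrite exprVn ler_pdivlMr ?exprn_gt0//; exact: H.
have small j : (j <= k0)%N -> v j <= \sum_(i < k0.+1) v i.
  move=> jk; have jk' : (j < k0.+1)%N by [].
  by rewrite (bigD1 (Ordinal jk')) //= lerDl sumr_ge0.
elim: k => [|k IH]; first exact: small.
have [/small//|kk] := leqP k.+1 k0.
by apply: le_trans IH; apply: vdec.
Qed.

End Recurrence.

(** * Zeros of Lipschitz functions *)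

Section IntermediateValue.
Context {R : realType}.
Lemma lipschitz_root (F : R -> R) (a b Q : R) : a <= b ->
    (forall x y, a <= x <= b -> a <= y <= b -> `|F x - F y| <= Q * `|x - y|) ->
    0 <= F a -> F b <= 0 ->
  exists2 c, a <= c <= b & F c = 0.
Proof.
move=> ab lipF Fa Fb.
suff cF : {within `[a, b], continuous F}.
  have [|c] := @IVT R F a b 0 ab cF; first by rewrite ge_min le_max Fa Fb orbT.
  by rewrite in_itv; exists c.
apply/subspace_continuousP => x xab; apply/cvgrPdist_le => e e0.
have Q1 : 0 < `|Q| + 1 by rewrite ltr_wpDl.
rewrite near_withinE; near=> y => yab.
move: xab yab; rewrite /= !in_itv => xab yab.
apply: le_trans (lipF x y xab yab) _.
apply: (@le_trans _ _ ((`|Q| + 1) * `|x - y|)).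
  by rewrite ler_wpM2r// (le_trans (ler_norm Q))// lerDl.
rewrite mulrC -ler_pdivlMr//; near: y.
by apply: cvgr_dist_le => //; rewrite divr_gt0.
Unshelve. all: by end_near. Qed.

End IntermediateValue.

(** * The line through a point of type I_0 *)

Section TypeI0.
Context {R : realType}.
Variables (p q : Z2) (Gamma : R).
Hypothesis p_neq0 : p != 0.
Hypothesis q_I0 : type_I0 R p q.
Hypothesis normalization : Gamma * (wedge q p)%:~R / (2 * nrm R p ^+ 2) = 1.

Implicit Types n : int.
Let rho := rho Gamma p q.
Let N := nrm R p ^+ 2.
Let h (n : int) := nrm R (q + p *~ n) ^+ 2.

Lemma nrm_p_gt0 : 0 < N. Proof. by rewrite exprn_gt0// nrm_gt0. Qed.

Lemma h_at0 : h 0 = nrm R q ^+ 2. Proof. by rewrite /h mulr0z addr0. Qed.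

(** On the line, the squared norm is [|q|^2 + 2 (p.q) n + |p|^2 n^2]; comparing
its values at [0] and at [1], [-1] with [|p|^2] gives the two bounds on
its coefficients from which the whole geometry of the line follows. *)
Lemma line_quadratic_bounds : `|2 * dot p q| < nrm R q ^+ 2 < N.
Proof.
case: q_I0 => _ qin qp qm.
have /qin : line p q q by exists 0; rewrite mulr0z addr0.
case=> _ /(_ erefl) qlt.
move: qlt qp qm; rewrite !nrm_lt -[q + p]/(q + p *~ 1) -[q - p]/(q + p *~ (-1)).
rewrite !nrm_line -/N rmorphN /= rmorph1 => a b c; rewrite a andbT ltr_norml.
by apply/andP; split; lra.
Qed.

Lemma nrm_q_gt0 : 0 < nrm R q ^+ 2.
Proof. by have /andP[/le_lt_trans + _] := line_quadratic_bounds; apply. Qed.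

(** Each difference [h n - h 1] and [h n - h (-1)] factors through
[n - 1] or [- n - 1], with a cofactor that the coefficient bounds make
nonnegative. *)
Lemma h_lower (n : int) : n != 0 -> Num.min (h 1) (h (-1)) <= h n.
Proof.
move=> n0; have /andP[] := line_quadratic_bounds; rewrite ltr_norml => /andP[a b] c.
have N0 := nrm_p_gt0.
rewrite ge_min /h !nrm_line -/N rmorphN rmorph1.
have : (1 <= n) || (n <= -1) by lia.
case/orP => n1; apply/orP; [left|right].
  have n1' : 1 <= n%:~R :> R by rewrite ler1z.
  suff : 0 <= (n%:~R - 1) * (2 * dot p q + N * (n%:~R + 1)) by lra.
  by rewrite mulr_ge0//; nra.
have n1' : n%:~R <= - 1 :> R by rewrite -[-1]/((-1)%:~R : R) ler_int.
suff : 0 <= (- n%:~R - 1) * (- (2 * dot p q) + N * (- n%:~R + 1)) by lra.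
by rewrite mulr_ge0//; nra.
Qed.

Lemma min_h_gt : N < Num.min (h 1) (h (-1)).
Proof.
case: q_I0 => _ _ qp qm.
by rewrite lt_min /h mulr1z mulrN1z -/N -!nrm_lt qp qm.
Qed.

Lemma h_pos n : 0 < h n.
Proof.
have [->|n0] := eqVneq n 0; first by rewrite h_at0 nrm_q_gt0.
by apply: lt_le_trans (h_lower _ n0); apply: lt_trans min_h_gt; exact: nrm_p_gt0.
Qed.

Lemma h_upper n : h n <= 2 * N * (1 + `|n|)%N%:R ^+ 2.
Proof.
have /andP[] := line_quadratic_bounds; rewrite ltr_norml => /andP[a b] c.
have N0 := nrm_p_gt0; rewrite /h nrm_line -/N natrD natr_absz intr_norm.
have n0 : 0 <= `|n%:~R : R| by [].
have : 2 * dot p q * n%:~R <= N * `|n%:~R|.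
  apply: le_trans (ler_norm _) _; rewrite normrM ler_wpM2r// ler_norml.
  by apply/andP; split; lra.
by rewrite -[n%:~R ^+ 2]real_normK ?num_real//; nra.
Qed.

Lemma h_quadratic n : N * (`|n|%N%:R ^+ 2 - `|n|%N%:R) <= h n.
Proof.
have /andP[] := line_quadratic_bounds; rewrite ltr_norml => /andP[a b] c.
have N0 := nrm_p_gt0; rewrite /h nrm_line -/N natr_absz intr_norm.
have n0 : 0 <= `|n%:~R : R| by [].
have : - (N * `|n%:~R|) <= 2 * dot p q * n%:~R.
  rewrite lerNl; apply: le_trans (ler_norm _) _.
  rewrite normrN normrM ler_wpM2r// ler_norml.
  by apply/andP; split; lra.
have := nrm_q_gt0; by rewrite -[n%:~R ^+ 2]real_normK ?num_real//; lra.
Qed.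

Lemma rhoE n : rho n = 1 - N / h n.
Proof.
have hn := h_pos n; have N0 := nrm_p_gt0.
have kn0 : q + p *~ n != 0.
  apply/eqP => e; move: hn; rewrite /h e nrm_sq /dot /=.
  by rewrite !mulr0 addr0 ltxx.
rewrite /rho /Defs.rho /beta (negbTE p_neq0) (negbTE kn0) /= -/N -/(h n) wedge_line.
have -> : wedge p q = - wedge q p by rewrite /wedge; ring.
have Nn : N != 0 by apply: lt0r_neq0.
have hnn : h n != 0 by apply: lt0r_neq0.
have /divr1_eq := normalization.
rewrite -/N rmorphN /=; move: (_%:~R) => W GW.
transitivity (- (Gamma * W) * (2^-1 * ((h n)^-1 - N^-1))); first by ring.
by rewrite GW; field; rewrite Nn hnn.
Qed.

Lemma rho_lt1 n : rho n < 1.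
Proof. by rewrite rhoE ltrBlDr ltrDl divr_gt0 ?nrm_p_gt0// h_pos. Qed.

Lemma rho0_lt0 : rho 0 < 0.
Proof.
rewrite rhoE subr_lt0 ltr_pdivlMr ?h_pos// mul1r h_at0.
by have /andP[_] := line_quadratic_bounds.
Qed.

(** [rho n] increases with [h n], so its infimum over [n != 0] is attained at
one of the two neighbours of the origin. *)
Definition rho_min : R := 1 - N / Num.min (h 1) (h (-1)).

Lemma rho_min_gt0 : 0 < rho_min.
Proof.
by rewrite subr_gt0 ltr_pdivrMr ?mul1r ?min_h_gt// (lt_trans nrm_p_gt0 min_h_gt).
Qed.

Lemma rho_ge n : n != 0 -> rho_min <= rho n.
Proof.
move=> n0; rewrite rhoE lerB// ler_pM2l ?nrm_p_gt0// lef_pV2 ?posrE ?h_pos//.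
  exact: h_lower.
exact: lt_trans nrm_p_gt0 min_h_gt.
Qed.

Let r0 := rho_min.
Let r0_gt0 : 0 < r0. Proof. exact: rho_min_gt0. Qed.
Let rho0 : rho 0 < 0. Proof. exact: rho0_lt0. Qed.

Lemma rho_gt0 n : n != 0 -> 0 < rho n.
Proof.
by move=> n0; apply: lt_le_trans (rho_ge n n0); exact: rho_min_gt0.
Qed.

Lemma rho_neq0 n : rho n != 0.
Proof.
have [->|/rho_gt0 /lt0r_neq0//] := eqVneq n 0.
by rewrite ltr0_neq0// rho0_lt0.
Qed.

Lemma rho_abs_ge : exists2 r, 0 < r & forall n, r <= `|rho n|.
Proof.
exists (Num.min r0 (- rho 0)).
  by rewrite lt_min rho_min_gt0//= oppr_gt0 rho0_lt0.
move=> n; rewrite ge_min; have [->|n0] := eqVneq n 0.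
  by rewrite -normrN ler_norm orbT.
by rewrite (le_trans (rho_ge n n0)) ?ler_norm.
Qed.

(** * The characteristic equation and the eigenvectors on the line *)

Section Coefficients.
Variables (nu lam : R).
Hypothesis nu0 : 0 <= nu.
Hypothesis lam0 : 0 < lam.
Let a := acoef Gamma p q lam nu.

Lemma acoef_ge n : n != 0 -> lam + nu * h n <= a n.
Proof.
move=> n0; rewrite /a /acoef ler_pdivlMr ?rho_gt0// -/(h n).
have hn := h_pos n.
have ln : 0 <= lam + nu * h n := addr_ge0 (ltW lam0) (mulr_ge0 nu0 (ltW hn)).
by rewrite ler_piMr// ltW// rho_lt1.
Qed.

Lemma acoef_ge_lam n : n != 0 -> lam <= a n.
Proof.
move=> n0; apply: le_trans (acoef_ge n n0).
by rewrite lerDl mulr_ge0// ltW// h_pos.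
Qed.

Lemma acoef_ge_index n : n != 0 -> nu * N * `|n|.-1%:R <= a n.
Proof.
move=> n0; apply: le_trans (acoef_ge n n0).
have := h_quadratic n; rewrite -/N -/(h n) => H.
apply: (@le_trans _ _ (nu * h n)); last by rewrite lerDr ltW.
rewrite -mulrA ler_wpM2l//; apply: le_trans H.
rewrite ler_wpM2l ?exprn_ge0 ?nrm_ge0//.
have [k ->] : exists k, `|n|%N = k.+1 by exists `|n|.-1; lia.
by rewrite -natr1 /=; have : 0 <= k%:R :> R by []; nra.
Qed.

Let cR k := a k.+1%:Z.
Let cL k := a (- k.+1%:Z).

Lemma cR_ge k : lam <= cR k. Proof. exact: acoef_ge_lam. Qed.
Lemma cL_ge k : lam <= cL k. Proof. exact: acoef_ge_lam. Qed.

(** Convergence of both fractions follows from [cR_ge] and [cL_ge]. *)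
Lemma characteristic_eqE :
  characteristic_eq Gamma p q lam nu <-> a 0 + cf cR + cf cL = 0.
Proof.
split=> [[_ _ //]|H]; split=> //.
  exact: (cf_trunc_cvg lam cR lam0 cR_ge).
exact: (cf_trunc_cvg lam cL lam0 cL_ge).
Qed.

(** The recurrence in the unknown [z n = rho n * w n], in which the coefficients
of the continued fractions appear. *)
Definition chain (z : int -> R) := forall n, z (n - 1) - z (n + 1) = a n * z n.

Lemma LBq_chain (x : int -> R) :
  (forall n, LBq Gamma p q nu (fun n => (x n)%:C) n = lam%:C * (x n)%:C) <->
  chain (fun n => rho n * x n).
Proof.
have aux n : a n * (rho n * x n) = lam * x n + nu * h n * x n.
  by rewrite /a /acoef -/(rho n) -/(h n); field; exact: rho_neq0.
split=> H n.
  have := H n; rewrite /LBq -/(rho _) -/(rho _) -/(h n) -!rmorphM -!rmorphB /=.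
  by move=> /complexI e; rewrite aux -e; ring.
rewrite /LBq -/(rho _) -/(rho _) -/(h n) -!rmorphM -!rmorphB /=; congr (_%:C).
by rewrite (H n) aux; ring.
Qed.

(** With the sign [(-1)^n], the left half of [z] satisfies the same recurrence as
the right half, so both ratios [z 1 / z 0] and [- z (-1) / z 0] are values of
continued fractions, and the recurrence at [0] relates them. *)
Lemma chain_characteristic (z : int -> R) : chain z ->
    (forall n : int, 0 <= n -> 0 < z n) ->
    (forall n : int, n <= 0 -> 0 < (-1) ^+ `|n|%N * z n) ->
  characteristic_eq Gamma p q lam nu.
Proof.
move=> zc zp zn; apply/characteristic_eqE.
pose y k := z k%:Z.
have yR : y 1%N / y 0%N = cf cR.
  apply: (cf_of_positive_solution lam) => [//||k|k].
  - exact: cR_ge.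
  - exact: zp.
  have := zc k.+1%:Z; rewrite /cR /y.
  have -> : k.+1%:Z - 1 = k by lia.
  have -> : k.+1%:Z + 1 = k.+2 by lia.
  by move=> <-; ring.
pose y' k := (-1) ^+ k * z (- k%:Z).
have yL : y' 1%N / y' 0%N = cf cL.
  apply: (cf_of_positive_solution lam) => [//||k|k].
  - exact: cL_ge.
  - by have := zn (- k%:Z); rewrite abszN absz_nat; apply; lia.
  have := zc (- k.+1%:Z); rewrite /cL /y'.
  have -> : - k.+1%:Z - 1 = - k.+2%:Z by lia.
  have -> : - k.+1%:Z + 1 = - k%:Z by lia.
  by move=> e; rewrite !exprS; nra.
have z0 : z 0 != 0 by rewrite lt0r_neq0// zp.
rewrite -yR -yL /y /y' oppr0 expr0 expr1 mul1r.
have := zc 0; rewrite sub0r add0r => e.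
have -> : a 0 = (z (-1) - z 1) / z 0 by rewrite e mulfK.
by field.
Qed.

Definition decaying_chain (n : int) : R :=
  match n with
  | Posz k => recessive cR k
  | Negz k => (-1) ^+ k.+1 * recessive cL k.+1
  end.

Lemma decaying_chainN k : decaying_chain (- k%:Z) = (-1) ^+ k * recessive cL k.
Proof. by case: k => [|k] /=; rewrite ?expr0 ?mul1r. Qed.

(** Only the recurrence at [0] couples the two halves, and there it is the
characteristic equation. *)
Lemma decaying_chainP : characteristic_eq Gamma p q lam nu -> chain decaying_chain.
Proof.
move=> /characteristic_eqE H [[|k]|k].
- rewrite sub0r add0r -[-1]/(- 1%:Z) decaying_chainN /= !mul1r expr1 mulr1.
  by rewrite -[RHS]addr0 -[in RHS]oppr0 -H; under [in LHS]eq_fun do rewrite add0n; ring.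
- have -> : k.+1%:Z - 1 = k by lia.
  have -> : k.+1%:Z + 1 = k.+2 by lia.
  rewrite [decaying_chain k](recessive_rec lam cR k)//; last exact: cR_ge.
  by rewrite /decaying_chain /cR; ring.
- rewrite NegzE.
  have -> : - k.+1%:Z - 1 = - k.+2%:Z by lia.
  have -> : - k.+1%:Z + 1 = - k%:Z by lia.
  rewrite !decaying_chainN (recessive_rec lam cL k)//; last exact: cL_ge.
  by rewrite !exprS /cL; ring.
Qed.

Lemma decaying_chain_decay M : 0 < nu -> exists2 C, 0 <= C & forall n : int,
  (1 + `|n|)%N%:R ^+ M * decaying_chain n ^+ 2 <= C * 2^-1 ^+ `|n|%N.
Proof.
move=> nu_gt0; have e0 : 0 < nu * N by rewrite mulr_gt0// nrm_p_gt0.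
have cRi k : nu * N * k%:R <= cR k by exact: (acoef_ge_index k.+1).
have cLi k : nu * N * k%:R <= cL k.
  by have := acoef_ge_index (- k.+1%:Z); rewrite abszN /=; apply.
have [C C0 HC] := recessive_decay lam (nu * N) cR lam0 e0 cR_ge cRi M.
have [D D0 HD] := recessive_decay lam (nu * N) cL lam0 e0 cL_ge cLi M.
exists (C + D); first exact: addr_ge0.
case=> k; rewrite mulrDl.
  by apply: le_trans (HC k) _; rewrite lerDl mulr_ge0// exprn_ge0.
rewrite NegzE decaying_chainN abszN absz_nat exprMn sqrr_sign mul1r.
by apply: le_trans (HD k.+1) _; rewrite lerDr mulr_ge0// exprn_ge0.
Qed.

Definition chain_mode (n : int) : R[i] := (decaying_chain n / rho n)%:C.

Lemma chain_mode_eigen : characteristic_eq Gamma p q lam nu ->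
  forall n, LBq Gamma p q nu chain_mode n = lam%:C * chain_mode n.
Proof.
move=> /decaying_chainP H; apply/LBq_chain => n.
have E k : rho k * (decaying_chain k / rho k) = decaying_chain k.
  by field; exact: rho_neq0.
by rewrite !E.
Qed.

Lemma chain_mode_decay : 0 < nu -> rapidly_decaying chain_mode.
Proof.
move=> nu_gt0 M; have [C C0 HC] := decaying_chain_decay M nu_gt0.
have [r rp Hr] := rho_abs_ge.
exists (C / r ^+ 2) => n.
have r20 : 0 < r ^+ 2 by rewrite exprn_gt0.
rewrite /chain_mode /sqmod /= expr0n addr0 expr_div_n mulrA.
apply: (@le_trans _ _ ((1 + `|n|)%N%:R ^+ M * decaying_chain n ^+ 2 / r ^+ 2)).
  apply: ler_wpM2l; first by rewrite mulr_ge0 ?sqr_ge0 ?exprn_ge0.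
  rewrite lef_pV2 ?posrE//.
    by rewrite -[leRHS]real_normK ?num_real// lerXn2r ?nnegrE// ltW.
  by rewrite lt0r sqr_ge0 sqrf_eq0 rho_neq0.
by rewrite [leRHS]mulrAC ler_pM2r ?invr_gt0.
Qed.

Lemma chain_mode_signS : signS_pos chain_mode.
Proof.
have gR k := recessive_gt0 lam cR k lam0 cR_ge.
have gL k := recessive_gt0 lam cL k lam0 cL_ge.
have rp n : n != 0 -> 0 < (rho n)^-1 by move=> /rho_gt0; rewrite invr_gt0.
have r00 : (rho 0)^-1 < 0 by rewrite invr_lt0 rho0_lt0.
split.
- move=> [[|k]|k]// _; rewrite /chain_mode ltcR mulr_gt0 ?rp//; exact: gR.
- rewrite /chain_mode ltcR -[-1]/(- 1%:Z) decaying_chainN expr1 mulN1r mulNr oppr_lt0.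
  by rewrite mulr_gt0 ?gL ?rp.
- by rewrite /chain_mode ltcR /= mul1r.
case=> [//|[//|k] _].
rewrite /chain_mode NegzE decaying_chainN abszN absz_nat.
rewrite -(rmorph_sign (real_complex R)) -rmorphM ltcR.
have j0 : - k.+2%:Z != 0 by lia.
move: k.+2 j0 => j j0.
by rewrite !mulrA -expr2 sqrr_sign mul1r mulr_gt0 ?gL ?rp.
Qed.

(** [rho 0 < 0] reverses the sign of the entry at [0]: this is why the sign
property, in terms of [w], asks for [w 0 < 0] next to positive entries on the
right, while [z] is positive there and at [0]. *)
Lemma signS_characteristic (w : int -> R[i]) : signS w ->
    (forall n, LBq Gamma p q nu w n = lam%:C * w n) ->
  characteristic_eq Gamma p q lam nu.
Proof.
wlog : w / signS_pos w.
  move=> W [sw|sw] E; first exact: (W w sw (or_introl sw)).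
  apply: (W _ sw (or_introl sw)) => n; rewrite mulrN -E /LBq; ring.
move=> [wp wm1 w0 wn] _ E.
pose x n := complex.Re (w n).
(* The sign property makes every entry a real number. *)
have imR (z : R[i]) : (0 < z) || (z < 0) -> z = (complex.Re z)%:C.
  by case: z => u v; rewrite !ltcE /= => /orP[/andP[/eqP -> _]|/andP[/eqP <- _]].
have wx n : w n = (x n)%:C.
  have : [|| 0 < n, n == -1, n == 0 | n <= -2] by lia.
  case/or4P => [/wp H|/eqP ->|/eqP ->|/wn H]; apply: imR.
  - by rewrite H.
  - by rewrite wm1 orbT.
  - by rewrite w0 orbT.
  - move: H; rewrite -signr_odd; case: odd; rewrite ?expr1 ?expr0 ?mul1r ?mulN1r.
      by rewrite oppr_gt0 => ->; rewrite orbT.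
    by move=> ->.
have wE : w = (fun n => (x n)%:C) by apply/funext.
move: E; rewrite wE => /LBq_chain zc.
apply: (chain_characteristic _ zc) => n n0.
  have [->|nn] := eqVneq n 0.
    by rewrite nmulr_rgt0 ?rho0_lt0//; move: w0; rewrite wx ltcR.
  rewrite mulr_gt0 ?rho_gt0//.
  have /wp : 0 < n by lia.
  by rewrite wx ltcR.
have [->|nn] := eqVneq n 0.
  by rewrite mul1r nmulr_rgt0 ?rho0_lt0//; move: w0; rewrite wx ltcR.
rewrite mulrCA mulr_gt0 ?rho_gt0//.
have [->|nn1] := eqVneq n (-1).
  by rewrite abszN expr1 mulN1r oppr_gt0; move: wm1; rewrite wx ltcR.
have /wn : n <= -2 by lia.
by rewrite wx -(rmorph_sign (real_complex R)) -rmorphM ltcR.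
Qed.

End Coefficients.

(** * Existence of a positive root *)

Section FixedViscosity.
Variable nu : R.
Hypothesis nu0 : 0 <= nu.
Let a lam := acoef Gamma p q lam nu.

Definition secular (lam : R) : R :=
  a lam 0 + cf (fun k => a lam k.+1%:Z) + cf (fun k => a lam (- k.+1%:Z)).

Lemma acoef_lipschitz n lam mu : n != 0 -> `|a lam n - a mu n| <= `|lam - mu| / r0.
Proof.
move=> n0; have rn : 0 < rho n by exact: rho_gt0.
rewrite /a /acoef -mulrBl opprD addrACA subrr addr0 normrM normfV ler_wpM2l//.
rewrite (gtr0_norm rn) lef_pV2 ?posrE//; exact: rho_ge.
Qed.

Lemma secular_lipschitz l b : 0 < l ->
  forall x y, l <= x <= b -> l <= y <= b ->
  `|secular x - secular y| <= ((- rho 0)^-1 + 2 * (cf_lip l / r0)) * `|x - y|.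
Proof.
move=> l0 x y /andP[lx _] /andP[ly _].
have ge z n : l <= z -> n != 0 -> l <= a z n.
  move=> lz n0; apply: (le_trans lz).
  by apply: acoef_ge_lam => //; lra.
have HR : `|cf (fun k => a x k.+1%:Z) - cf (fun k => a y k.+1%:Z)|
    <= cf_lip l * (`|x - y| / r0).
  by apply: cf_lipschitz => // k; rewrite ?ge// acoef_lipschitz.
have HL : `|cf (fun k => a x (- k.+1%:Z)) - cf (fun k => a y (- k.+1%:Z))|
    <= cf_lip l * (`|x - y| / r0).
  by apply: cf_lipschitz => // k; rewrite ?ge// acoef_lipschitz.
have H0 : `|a x 0 - a y 0| <= `|x - y| * (- rho 0)^-1.
  by rewrite /a /acoef -mulrBl opprD addrACA subrr addr0 normrM normfV (ltr0_norm rho0).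
have -> : secular x - secular y = (a x 0 - a y 0)
    + (cf (fun k => a x k.+1%:Z) - cf (fun k => a y k.+1%:Z))
    + (cf (fun k => a x (- k.+1%:Z)) - cf (fun k => a y (- k.+1%:Z))).
  by rewrite /secular; ring.
apply: le_trans (ler_normD _ _) _; apply: le_trans (lerD (ler_normD _ _) HL) _.
by apply: le_trans (lerD (lerD H0 HR) (lexx _)) _; lra.
Qed.

(** Each fraction is at most [1 / L], and [a_0 <= L / rho 0 <= - 2 / L]. *)
Lemma secular_neg (L : R) : 1 <= L -> - 2 * rho 0 <= L -> secular L <= 0.
Proof.
move=> L1 L2; have L0 : 0 < L by lra.
have small n : n != 0 -> L <= a L n by move=> n0; apply: acoef_ge_lam.
have b c : (forall k, L <= c k) -> cf c <= L^-1.
  move=> cL; apply: le_trans (cf_le _ _ L0 cL) _.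
  by rewrite lef_pV2 ?posrE// (lt_le_trans L0).
have := b (fun k => a L k.+1%:Z) (fun k => small k.+1%:Z isT).
have := b (fun k => a L (- k.+1%:Z)) (fun k => small (- k.+1%:Z) isT).
have : a L 0 <= - 2 / L.
  rewrite /a /acoef -/(rho 0) -/(h 0) ler_ndivrMr//.
  have h0 : 0 < h 0 by exact: h_pos.
  have := mulr_ge0 nu0 (ltW h0) => nh.
  apply: (@le_trans _ _ L); last by lra.
  rewrite -mulrAC ler_pdivrMr//; nra.
by rewrite /secular; lra.
Qed.

(** Both [l] and [nu * h n] are at most [l] on the first [2 K] levels, so the
coefficients there are at most [2 l / r0] and the two fractions together
contribute at least [K * l], whereas [- a_0 <= 2 l / |rho 0| <= K * l]. *)
Lemma secular_pos (K : nat) (l : R) : 0 < l ->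
    2 <= K%:R * - rho 0 ->
    2 * (2 / r0) * (K.+1%:R * l) ^+ 2 <= 1 ->
    (forall n, (`|n| <= K.*2)%N -> nu * h n <= l) ->
  0 <= secular l.
Proof.
move=> l0 K2 sm hl.
have C0 : 0 < 2 / r0 by rewrite divr_gt0.
have ge n : n != 0 -> l <= a l n by move=> n0; apply: acoef_ge_lam.
have le n : n != 0 -> (`|n| <= K.*2)%N -> a l n <= 2 / r0 * l.
  move=> n0 nK; have rn : 0 < rho n by exact: rho_gt0.
  rewrite /a /acoef -/(rho n) -/(h n) ler_pdivrMr//.
  have := hl n nK => H; apply: (@le_trans _ _ (2 * l)); first lra.
  have rr : r0 <= rho n by exact: rho_ge.
  have -> : 2 / r0 * l * rho n = 2 * l * (rho n / r0) by ring.
  by rewrite ler_peMr ?ler_pdivlMr ?mul1r// mulr_ge0// ltW.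
have bR : K%:R * l / 2 <= cf (fun k => a l k.+1%:Z).
  by apply: (cf_lower_bound K _ l (2 / r0)) => // k; [exact: ge|move=> kK; apply: le; lia].
have bL : K%:R * l / 2 <= cf (fun k => a l (- k.+1%:Z)).
  by apply: (cf_lower_bound K _ l (2 / r0)) => // k; [exact: ge|move=> kK; apply: le; lia].
have b0 : - (K%:R * l) <= a l 0.
  rewrite /a /acoef -/(rho 0) -/(h 0) ler_ndivlMr//.
  have := hl 0 (leq0n _) => H; nra.
by rewrite /secular; lra.
Qed.

End FixedViscosity.

(** The order of the choices matters: the number [K] of levels depends only on
[rho 0], the left end point [l] on [K] and [r0], and the bound on the viscosity
on both, through an upper bound for [h n] with [|n| <= 2 K]. *)
Lemma characteristic_eq_solvable : exists nu0 : R, 0 < nu0 /\ forall nu, 0 < nu < nu0 ->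
  exists2 lam, 0 < lam & characteristic_eq Gamma p q lam nu.
Proof.
pose K := Num.bound (2 / - rho 0).
have K2 : 2 <= K%:R * - rho 0.
  rewrite -ler_pdivrMr ?oppr_gt0//; apply/ltW/archi_boundP.
  by rewrite divr_ge0// oppr_ge0 ltW.
pose D := 2 * (2 / r0) * K.+1%:R ^+ 2.
have D0 : 0 <= D by rewrite /D !mulr_ge0 ?exprn_ge0 ?invr_ge0// ltW.
(* Then [D * l <= 1] and [l <= 1], hence [D * l^2 <= 1]. *)
pose l := (1 + D)^-1.
have l0 : 0 < l by rewrite invr_gt0; lra.
have l1 : l <= 1 by rewrite invf_le1; lra.
have N0 : 0 < N by exact: nrm_p_gt0.
pose H := 2 * N * (1 + K.*2)%N%:R ^+ 2.
have H0 : 0 < H by apply: mulr_gt0; [exact: mulr_gt0|rewrite exprn_gt0// ltr0n].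
exists (l / H); split; first by rewrite divr_gt0.
move=> nu /andP[nu0 nuH]; have nu0' := ltW nu0.
have hl n : (`|n| <= K.*2)%N -> nu * h n <= l.
  move=> nK; move: nuH; rewrite ltr_pdivlMr// => /ltW; apply: le_trans.
  rewrite ler_wpM2l//; apply: le_trans (h_upper n) _.
  apply: ler_wpM2l; first by rewrite mulr_ge0// ltW.
  by rewrite lerXn2r ?nnegrE// ler_nat; lia.
have sm : 2 * (2 / r0) * (K.+1%:R * l) ^+ 2 <= 1.
  have -> : 2 * (2 / r0) * (K.+1%:R * l) ^+ 2 = D * l * l by rewrite /D; ring.
  have Dl : D * l <= 1 by rewrite -ler_pdivlMr// div1r invrK lerDr.
  exact: (mulr_ile1 (mulr_ge0 D0 (ltW l0)) (ltW l0) Dl l1).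
pose L := 1 - 2 * rho 0.
have lL : l <= L by rewrite /L; have := rho0; lra.
have Fl : 0 <= secular nu l by exact: secular_pos K2 sm hl.
have FL : secular nu L <= 0 by apply: secular_neg; rewrite // /L; have := rho0; lra.
have [c] := lipschitz_root _ _ _ _ lL (secular_lipschitz nu nu0' l L l0) Fl FL.
move=> /andP[lc _] c0; exists c; first lra.
by apply/characteristic_eqE => //; lra.
Qed.

(** Translations by [p] and [-p] preserve the line, so the full operator couples no
point of the line with a point outside. *)
Lemma LB_line_ext nu (w : int -> R[i]) (lam : R[i]) :
    (forall n, LBq Gamma p q nu w n = lam * w n) ->
  forall k, LB Gamma p nu (line_ext p q w) k = lam * line_ext p q w k.
Proof.
move=> E k; have [[n ->]|out] := pselect (exists n : int, k = q + p *~ n).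
  rewrite /LB.
  have -> : q + p *~ n - p = q + p *~ (n - 1) by rewrite mulrzBr mulr1z addrA.
  have -> : q + p *~ n + p = q + p *~ (n + 1) by rewrite mulrzDr mulr1z addrA.
  by rewrite !line_ext_line// -E /LBq /Defs.rho !(mulrC Gamma).
rewrite /LB !line_ext_out ?mulr0 ?subr0// => -[n e]; apply: out.
  by exists (n - 1); rewrite mulrzBr mulr1z addrA -e addrK.
by exists (n + 1); rewrite mulrzDr mulr1z addrA -e subrK.
Qed.

Lemma line_ext_l2Z2 (w : int -> R[i]) (s : R) : 0 <= s ->
  rapidly_decaying w -> l2Z2 s (line_ext p q w).
Proof.
move=> s0 dw; rewrite /l2Z2 /= /summable.
set f := fun k : Z2 => _; pose pt n := q + p *~ n.
have -> : (\esum_(k in [set: Z2]) f k = \esum_(k in range pt) f k)%E.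
  rewrite [RHS]esum_mkcond; apply: eq_esum => k _; case: ifPn => // /negP kn.
  rewrite /f line_ext_out; first by rewrite /sqmod /= expr0n addr0 mulr0 normr0.
  by move=> [n kE]; apply: kn; rewrite inE; exists n.
rewrite esum_image; last by move=> x y _ _; apply: line_inj.
have N0 : 0 < N by exact: nrm_p_gt0.
have := rapidly_decaying_summable w (fun n => nrm R (q + p *~ n)) (1 + 2 * N) s _ _ s0 dw.
rewrite /summable /f; under [X in _ -> (X < _)%E]eq_esum => n _ do rewrite line_ext_line//.
apply; first lra.
move=> n; rewrite nrm_ge0 /=.
have n1 : 1 <= (1 + `|n|)%N%:R :> R by rewrite ler1n.
rewrite -ler_sqr ?nnegrE ?nrm_ge0//; last by rewrite mulr_ge0//; lra.
apply: le_trans (h_upper n) _; rewrite exprMn.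
by apply: ler_wpM2r; [rewrite exprn_ge0|rewrite -/N; nra].
Qed.

End TypeI0.

(** * The Kolmogorov flow is a steady state *)

Section KolmogorovFlow.
Context {R : realType}.
Implicit Types (A k c x : R) (p : Z2).

Lemma derive_affine k c x : is_derive x 1 (fun t : R => k * t + c) k.
Proof. by apply: is_derive_eq; rewrite addr0 [_ *: _]mulr1 ?scaler0 ?addr0. Qed.

Lemma derive_cos_affine A k c x :
  derive1 (fun t : R => A * cos (k * t + c)) x = - (A * k) * sin (k * x + c).
Proof.
rewrite derive1E; have H := derive_affine k c x.
have H2 := @is_derive1_comp R cos (fun t => k * t + c) x _ _ (is_derive_cos (k * x + c)) H.
have := @is_deriveZ R _ _ _ A x 1 _ H2.
move=> H3; rewrite (@derive_val _ _ _ _ _ _ _ H3).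
by rewrite /GRing.scale /=; ring.
Qed.

Lemma derive_sin_affine A k c x :
  derive1 (fun t : R => A * sin (k * t + c)) x = A * k * cos (k * x + c).
Proof.
rewrite derive1E; have H := derive_affine k c x.
have H2 := @is_derive1_comp R sin (fun t => k * t + c) x _ _ (is_derive_sin (k * x + c)) H.
have := @is_deriveZ R _ _ _ A x 1 _ H2.
move=> H3; rewrite (@derive_val _ _ _ _ _ _ _ H3).
by rewrite /GRing.scale /=; ring.
Qed.

Definition wave_cos A p (x y : R) : R := A * cos (phase p x y).
Definition wave_sin A p (x y : R) : R := A * sin (phase p x y).

Lemma phaseC p x y : phase p x y = p.2%:~R * y + p.1%:~R * x.
Proof. exact: addrC. Qed.

Lemma dx_wave_cos A p : dx (wave_cos A p) = wave_sin (- (A * p.1%:~R)) p.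
Proof. by apply/funext => x; apply/funext => y; exact: derive_cos_affine. Qed.

Lemma dx_wave_sin A p : dx (wave_sin A p) = wave_cos (A * p.1%:~R) p.
Proof. by apply/funext => x; apply/funext => y; exact: derive_sin_affine. Qed.

Lemma dy_wave_cos A p : dy (wave_cos A p) = wave_sin (- (A * p.2%:~R)) p.
Proof.
apply/funext => x; apply/funext => y; rewrite /dy /wave_cos /wave_sin phaseC.
by under [in LHS]eq_fun do rewrite phaseC; exact: derive_cos_affine.
Qed.

Lemma dy_wave_sin A p : dy (wave_sin A p) = wave_cos (A * p.2%:~R) p.
Proof.
apply/funext => x; apply/funext => y; rewrite /dy /wave_cos /wave_sin phaseC.
by under [in LHS]eq_fun do rewrite phaseC; exact: derive_sin_affine.
Qed.

Lemma laplacian_wave_cos A p x y :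
  laplacian (wave_cos A p) x y = - nrm R p ^+ 2 * wave_cos A p x y.
Proof.
rewrite /laplacian dx_wave_cos dx_wave_sin dy_wave_cos dy_wave_sin.
by rewrite nrm_sq /dot /wave_cos; ring.
Qed.

Lemma cos_periodz (n : int) x : cos (x + 2 * pi * n%:~R) = cos x.
Proof.
have nat_case (m : nat) z : cos (z + 2 * pi * m%:R) = cos z :> R.
  rewrite mulr_natr; have -> : 2 * pi = pi *+ 2 :> R by rewrite mulr_natl.
  exact: periodicn (@cosD2pi R) m z.
case: n => n; first exact: nat_case.
by rewrite NegzE rmorphN mulrN -[LHS](nat_case n.+1) subrK.
Qed.

Lemma wave_cos_torus A p : on_torus (wave_cos A p).
Proof.
move=> x y; rewrite /wave_cos /phase; split.
  by rewrite -[in RHS](cos_periodz p.1); congr (_ * cos _); ring.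
by rewrite -[in RHS](cos_periodz p.2); congr (_ * cos _); ring.
Qed.

(** The velocity is orthogonal to [p], along which the vorticity varies, so the
transport term vanishes; the forcing balances the viscous term since the wave is
an eigenfunction of the Laplacian. *)
Lemma kolmogorov_steady (Gamma nu : R) p : p != 0 ->
  steady_NS nu (psi0 Gamma p) (omega0 Gamma p) (u0 Gamma p) (forcing Gamma p).
Proof.
move=> p0; have n0 : nrm R p != 0 by rewrite lt0r_neq0// nrm_gt0.
rewrite -[psi0 _ _]/(wave_cos (Gamma / nrm R p ^+ 2) p).
rewrite -[omega0 _ _]/(wave_cos Gamma p).
rewrite -[forcing _ _]/(wave_cos (nrm R p ^+ 2 * Gamma) p).
split; try exact: wave_cos_torus.
- move=> x y; rewrite dy_wave_cos dx_wave_cos /u0 /wave_sin.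
  by congr (_, _); ring.
- by move=> x y; rewrite laplacian_wave_cos /wave_cos; field.
- move=> x y; rewrite dx_wave_cos dy_wave_cos laplacian_wave_cos /u0 /wave_sin /wave_cos /=.
  by ring.
Qed.

End KolmogorovFlow.

(** * Instability *)

Theorem theorem2p9 (R : realType) (p q : Z2) (Gamma : R)
    (p_neq0 : p != 0)
    (q_I0 : type_I0 R p q)
    (q_nparallel : wedge q p != 0)
    (normalization : Gamma * (wedge q p)%:~R / (2 * nrm R p ^+ 2) = 1) :
  (forall nu : R, 0 < nu ->
     steady_NS nu (psi0 Gamma p) (omega0 Gamma p) (u0 Gamma p)
       (forcing Gamma p)) /\
  (exists nu0 : R, 0 < nu0 /\
     forall nu : R, 0 < nu < nu0 ->
       [/\ linearly_unstable Gamma p nu,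
           forall s : R, 0 <= s ->
             (exists2 lambda : R, 0 < lambda &
                eigenvalue_in (l2Z s) (LBq Gamma p q nu) lambda%:C) /\
             (exists2 lambda : R, 0 < lambda &
                eigenvalue_in (l2Z2 s) (LB Gamma p nu) lambda%:C)
         & forall s : R, 0 <= s -> forall lambda : R, 0 < lambda ->
             ((exists w, eigenpair (l2Z s) (LBq Gamma p q nu) lambda%:C w
                         /\ signS w)
              <-> characteristic_eq Gamma p q lambda nu)]).
Proof.
split; first by move=> nu _; exact: kolmogorov_steady.
have [nu0 [nu0_gt0 Hroot]] := characteristic_eq_solvable p q Gamma p_neq0 q_I0 normalization.
exists nu0; split=> // nu nu_itv; have /andP[nu_gt0 _] := nu_itv.
have nu_ge0 := ltW nu_gt0.
have chain_eigenpair s lam : 0 <= s -> 0 < lam ->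
    characteristic_eq Gamma p q lam nu ->
  eigenpair (l2Z s) (LBq Gamma p q nu) lam%:C (chain_mode p q Gamma nu lam).
  move=> s0 lam0 H.
  have dw := chain_mode_decay p q Gamma p_neq0 q_I0 normalization _ _ nu_ge0 lam0 nu_gt0.
  have E := chain_mode_eigen p q Gamma p_neq0 q_I0 normalization _ _ nu_ge0 lam0 H.
  split=> //.
  - exact: rapidly_decaying_l2Z.
  - rewrite (_ : LBq _ _ _ _ _ = fun n => lam%:C * chain_mode p q Gamma nu lam n).
      exact/rapidly_decaying_l2Z/rapidly_decayingZ.
    exact/funext.
  - have [w1 _ _ _] := chain_mode_signS p q Gamma p_neq0 q_I0 normalization _ _ nu_ge0 lam0.
    by exists 1; rewrite gt_eqF// w1.
have [lam lam0 Hlam] := Hroot nu nu_itv.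
have lattice_eigen s : 0 <= s -> eigenvalue_in (l2Z2 s) (LB Gamma p nu) lam%:C.
  move=> s0; exists (line_ext p q (chain_mode p q Gamma nu lam)).
  have dw := chain_mode_decay p q Gamma p_neq0 q_I0 normalization _ _ nu_ge0 lam0 nu_gt0.
  have [_ _ [n wn] E] := chain_eigenpair s lam s0 lam0 Hlam.
  have E2 := LB_line_ext p q Gamma p_neq0 nu _ _ E.
  split=> //.
  - exact: line_ext_l2Z2.
  - rewrite (_ : LB _ _ _ _ = line_ext p q (fun n => lam%:C * chain_mode p q Gamma nu lam n)).
      exact/line_ext_l2Z2/rapidly_decayingZ.
    apply/funext => k; rewrite E2.
    have [[m ->]|out] := pselect (exists m : int, k = q + p *~ m).
      by rewrite !line_ext_line.
    by rewrite !line_ext_out ?mulr0.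
  - by exists (q + p *~ n); rewrite line_ext_line.
split.
- by move=> s s0; exists lam%:C => //; exact: lattice_eigen.
- move=> s s0; split; exists lam => //; last exact: lattice_eigen.
  by exists (chain_mode p q Gamma nu lam); exact: chain_eigenpair.
move=> s s0 mu mu0; split.
  move=> [w [[_ _ _ E] sw]].
  exact: (signS_characteristic p q Gamma p_neq0 q_I0 normalization nu mu nu_ge0 mu0 w sw E).
move=> H; exists (chain_mode p q Gamma nu mu); split; first exact: chain_eigenpair.
by left; exact: (chain_mode_signS p q Gamma p_neq0 q_I0 normalization _ _ nu_ge0 mu0).
Qed.
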